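(* The Dehn function of Stallings' group $S$ is quadratic; that is, the Dehn function $\delta$ of any finite presentation of $S$ satisfies $\delta(n) \simeq n^2$.
   Context: Notation: $x^y := y^{-1}xy$, $[x,y] := x^{-1}y^{-1}xy$. Stallings' group is $$S=\langle a,b,c,d,s \mid [a,c],\ [a,d],\ [b,c],\ [b,d],\ s^a=s^b=s^c=s^d\rangle,$$ where $s^a=s^b=s^c=s^d$ is shorthand for the six relations equating pairs among $s^a,s^b,s^c,s^d$. (It is isomorphic to the kernel of the homomorphism $F(\alpha,\beta)\times F(\gamma,\delta)\times F(\epsilon,\zeta)\to\mathbb{Z}=\langle t\rangle$ from a product of three rank-2 free groups sending all six generators to $t$.) For a finite presentation $\langle \mathcal{A}\mid\mathcal{R}\rangle$, a word $w$ representing the identity can be converted to the empty word by a finite sequence of words, each obtained from the previous one by a free reduction ($\alpha xx^{-1}\beta\mapsto\alpha\beta$, $x\in\mathcal{A}^{\pm1}$), a free expansion (the inverse move), or an application of a relator ($\alpha u\beta\mapsto\alpha v\beta$ where a cyclic conjugate of $uv^{-1}$ lies in $\mathcal{R}^{\pm1}$). The cost of the sequence is the number of application-of-a-relator moves. $\mathrm{Area}(w)$ is the minimal cost among all such sequences, and the Dehn function $\delta:\mathbb{N}\to\mathbb{N}$ is $\delta(n)=\max\{\mathrm{Area}(w)\mid w \text{ represents } 1 \text{ and } \ell(w)\le n\}$, where $\ell(w)$ is the length of $w$ as a word. For $f,g:\mathbb{N}\to\mathbb{N}$, $f\preceq g$ means there is $C>0$ such that $f(n)\le Cg(Cn+C)+Cn+C$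 for all $n\in\mathbb{N}$; $f\simeq g$ means $f\preceq g$ and $g\preceq f$. *)

(* Defs.v *)
From HB Require Import structures.
From mathcomp Require Import all_boot.
From mathcomp Require Import boolp.

Set Implicit Arguments.
Unset Strict Implicit.
Unset Printing Implicit Defensive.

(* A letter (x, e) stands for x when e = false and for x^-1 when e = true.
   Words are not required to be freely reduced. *)
Definition letter (A : Type) : Type := (A * bool)%type.
Definition word (A : Type) : Type := seq (letter A).

Section Words.
Variable A : Type.
Implicit Types (l : letter A) (u v w : word A).

Definition letter_inv l : letter A := (l.1, ~~ l.2).
Definition word_inv w : word A := rev (map letter_inv w).
Definition word_conj u v : word A := word_inv v ++ u ++ v.
Definition word_comm u v : word A := word_inv u ++ word_inv v ++ u ++ v.

Lemma letter_invK : involutive letter_inv.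
Proof. by case=> x e; rewrite /letter_inv /= negbK. Qed.

Lemma word_invK : involutive word_inv.
Proof.
move=> w; rewrite /word_inv map_rev revK -map_comp -[RHS]map_id.
by apply: eq_map; exact: letter_invK.
Qed.

Lemma word_inv_cat u v : word_inv (u ++ v) = word_inv v ++ word_inv u.
Proof. by rewrite /word_inv map_cat rev_cat. Qed.

Lemma word_inv_cons l w : word_inv (l :: w) = word_inv w ++ [:: letter_inv l].
Proof. by rewrite /word_inv /= rev_cons cats1. Qed.

End Words.

Record finpres := FinPres {
  gens :> finType;
  rels : seq (word gens)
}.

(* Equality of words in the presented group: the least congruence identifying
   the words x x^-1 (x a letter) and all the relators with the empty word. *)
Inductive pres_eq (P : finpres) : word P -> word P -> Prop :=
| pres_eq_refl u : pres_eq u u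
| pres_eq_sym u v : pres_eq u v -> pres_eq v u
| pres_eq_trans u v w : pres_eq u v -> pres_eq v w -> pres_eq u w
| pres_eq_cat u u' v v' :
    pres_eq u u' -> pres_eq v v' -> pres_eq (u ++ v) (u' ++ v')
| pres_eq_cancel (l : letter P) : pres_eq [:: l; letter_inv l] [::]
| pres_eq_rel r : r \in rels P -> pres_eq r [::].

Section PresentedGroup.
Variable P : finpres.
Implicit Types u v w : word P.
Local Open Scope quotient_scope.

Definition pres_rel u v : bool := `[< pres_eq u v >].

Lemma pres_rel_refl : reflexive pres_rel.
Proof. by move=> u; apply/asboolP; exact: pres_eq_refl. Qed.

Lemma pres_rel_sym : symmetric pres_rel.
Proof. by move=> u v; apply/asboolP/asboolP; exact: pres_eq_sym. Qed.

Lemma pres_rel_trans : transitive pres_rel.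
Proof.
move=> v u w /asboolP uv /asboolP vw; apply/asboolP; exact: pres_eq_trans vw.
Qed.

Canonical pres_equiv :=
  EquivRel pres_rel pres_rel_refl pres_rel_sym pres_rel_trans.

Definition pres_group : Type := {eq_quot pres_rel}.
HB.instance Definition _ := Choice.on pres_group.

Definition pres_class w : pres_group := \pi_({eq_quot pres_rel}) w.

Lemma pres_classP u v : pres_class u = pres_class v <-> pres_eq u v.
Proof.
split=> [/eqP | uv]; first by rewrite eqmodE => /asboolP.
by apply/eqP; rewrite eqmodE; apply/asboolP.
Qed.

Definition pres_repr (g : pres_group) : word P := repr (g : {eq_quot pres_rel}).

Lemma pres_reprK : cancel pres_repr pres_class.
Proof. by move=> g; exact: reprK. Qed.

Lemma pres_repr_class w : pres_eq (pres_repr (pres_class w)) w.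
Proof. by apply/pres_classP; rewrite pres_reprK. Qed.

Definition pres_one : pres_group := pres_class [::].
Definition pres_mul (g h : pres_group) : pres_group :=
  pres_class (pres_repr g ++ pres_repr h).
Definition pres_inv (g : pres_group) : pres_group :=
  pres_class (word_inv (pres_repr g)).

Lemma pres_class_cat u v :
  pres_class (u ++ v) = pres_mul (pres_class u) (pres_class v).
Proof.
apply/pres_classP/pres_eq_sym.
by apply: pres_eq_cat; exact: pres_repr_class.
Qed.

Lemma pres_eq_mulV w : pres_eq (w ++ word_inv w) [::].
Proof.
elim: w => [|l w IHw]; first exact: pres_eq_refl.
rewrite word_inv_cons cat_cons catA -cat1s.
apply: pres_eq_trans (pres_eq_cancel l).
rewrite -[[:: l; _]]/([:: l] ++ ([::] ++ [:: letter_inv l])).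
apply: pres_eq_cat; first exact: pres_eq_refl.
by apply: pres_eq_cat => //; exact: pres_eq_refl.
Qed.

Lemma pres_mulA : associative pres_mul.
Proof.
move=> g h k; rewrite -[g]pres_reprK -[h]pres_reprK -[k]pres_reprK.
by rewrite -!pres_class_cat catA.
Qed.

Lemma pres_mul1 : left_id pres_one pres_mul.
Proof. by move=> g; rewrite -[g]pres_reprK -pres_class_cat. Qed.

Lemma pres_mulr1 : right_id pres_one pres_mul.
Proof. by move=> g; rewrite -[g]pres_reprK -pres_class_cat cats0. Qed.

Lemma pres_mulV : left_inverse pres_one pres_inv pres_mul.
Proof.
move=> g; rewrite -[X in pres_mul _ X]pres_reprK -pres_class_cat.
apply/pres_classP; rewrite -[X in _ ++ X]word_invK; exact: pres_eq_mulV.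
Qed.

Lemma pres_mulrV : right_inverse pres_one pres_inv pres_mul.
Proof.
move=> g; rewrite -[X in pres_mul X _]pres_reprK -pres_class_cat.
by apply/pres_classP; exact: pres_eq_mulV.
Qed.

HB.instance Definition _ := isGroup.Build pres_group
  pres_mulA pres_mul1 pres_mulr1 pres_mulV pres_mulrV.

Definition represents_one w : Prop := pres_class w = 1%g.

End PresentedGroup.

Definition isomorphic (G H : groupType) : Prop :=
  exists f : {multiplicative G -> H}, bijective f.

Section Dehn.
Variable P : finpres.
Implicit Types u v w : word P.

Inductive free_reduction : word P -> word P -> Prop :=
| FreeReduction alpha beta (l : letter P) :
    free_reduction (alpha ++ [:: l; letter_inv l] ++ beta) (alpha ++ beta).

Definition relator_or_inverse w : Prop := w \in rels P \/ word_inv w \in rels P.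

Inductive relator_move : word P -> word P -> Prop :=
| RelatorMove alpha beta u v k :
    relator_or_inverse (rot k (u ++ word_inv v)) ->
    relator_move (alpha ++ u ++ beta) (alpha ++ v ++ beta).

Inductive derives : word P -> word P -> nat -> Prop :=
| derives_refl w : derives w w 0
| derives_reduce u v w n :
    free_reduction u v -> derives v w n -> derives u w n
| derives_expand u v w n :
    free_reduction v u -> derives v w n -> derives u w n
| derives_relator u v w n :
    relator_move u v -> derives v w n -> derives u w n.+1.

(* A word representing 1 always derives the empty word, so the second case does
   not arise for such words: see areaP below. *)
Definition area w : nat :=
  match pselect (exists n, `[< derives w [::] n >]) with
  | left derivable => ex_minn derivable
  | right _ => 0
  end.

Definition dehn (n : nat) : nat :=
  \max_(m < n.+1)
    \max_(w : m.-tuple (letter P) | `[< represents_one (w : word P) >]) area w.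

Lemma derives_trans u v w m n :
  derives u v m -> derives v w n -> derives u w (m + n).
Proof.
move=> d; elim: d n => // {u v m}.
- by move=> u v x m uv _ IH n /IH; exact: derives_reduce.
- by move=> u v x m uv _ IH n /IH; exact: derives_expand.
- by move=> u v x m uv _ IH n /IH; exact: derives_relator.
Qed.

Lemma free_reduction_cat x y u v :
  free_reduction u v -> free_reduction (x ++ u ++ y) (x ++ v ++ y).
Proof.
case=> alpha beta l.
by have := FreeReduction (x ++ alpha) (beta ++ y) l; rewrite -!catA.
Qed.

Lemma relator_move_cat x y u v :
  relator_move u v -> relator_move (x ++ u ++ y) (x ++ v ++ y).
Proof.
case=> alpha beta {}u {}v k r.
by have := RelatorMove (x ++ alpha) (beta ++ y) r; rewrite -!catA.
Qed.

Lemma relator_or_inverseV w :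
  relator_or_inverse w -> relator_or_inverse (word_inv w).
Proof. by case=> ?; [right; rewrite word_invK | left]. Qed.

Lemma relator_move_sym u v : relator_move u v -> relator_move v u.
Proof.
case=> alpha beta {}u {}v k /relator_or_inverseV r.
apply: (@RelatorMove _ _ _ _ (size (v ++ word_inv u) - k)).
suff -> : rot (size (v ++ word_inv u) - k) (v ++ word_inv u) =
          word_inv (rot k (u ++ word_inv v)) by [].
have <- : word_inv (u ++ word_inv v) = v ++ word_inv u.
  by rewrite word_inv_cat word_invK.
by rewrite /word_inv map_rot rev_rot -/(rotr k _).
Qed.

Lemma derives_cat x y u v n :
  derives u v n -> derives (x ++ u ++ y) (x ++ v ++ y) n.
Proof.
elim=> {u v n} [w|u v w n uv _|u v w n vu _|u v w n uv _].
- exact: derives_refl.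
- by apply: derives_reduce; exact: free_reduction_cat.
- by apply: derives_expand; exact: free_reduction_cat.
- by apply: derives_relator; exact: relator_move_cat.
Qed.

Lemma derives_sym u v n : derives u v n -> derives v u n.
Proof.
elim=> {u v n} [w|u v w n uv _ IH|u v w n vu _ IH|u v w n uv _ IH].
- exact: derives_refl.
- rewrite -[n]addn0; apply: derives_trans IH _.
  by apply: derives_expand uv _; exact: derives_refl.
- rewrite -[n]addn0; apply: derives_trans IH _.
  by apply: derives_reduce vu _; exact: derives_refl.
- rewrite -addn1; apply: derives_trans IH _.
  by apply: derives_relator (relator_move_sym uv) _; exact: derives_refl.
Qed.

Lemma pres_eq_derives u v : pres_eq u v -> exists n, derives u v n.
Proof.
elim=> {u v} [u|u v _ [n d]|u v w _ [m d] _ [n e]|u u' v v' _ [m d] _ [n e]|l|r Rr].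
- by exists 0; exact: derives_refl.
- by exists n; exact: derives_sym.
- by exists (m + n); exact: derives_trans e.
- exists (m + n); apply: (@derives_trans _ (u' ++ v)).
    exact: (derives_cat [::] v d).
  by have := derives_cat u' [::] e; rewrite !cats0.
- exists 0; apply: derives_reduce (derives_refl _).
  exact: (FreeReduction [::] [::] l).
- exists 1; apply: derives_relator (derives_refl _).
  rewrite -[r]cats0; apply: (@RelatorMove [::] [::] r [::] 0).
  by rewrite rot0 cats0; left.
Qed.

Lemma represents_one_derives w :
  represents_one w -> exists n, derives w [::] n.
Proof. by move/pres_classP/pres_eq_derives. Qed.

Lemma areaP w : represents_one w ->
  derives w [::] (area w) /\ forall n, derives w [::] n -> area w <= n.
Proof.
move=> /represents_one_derives [k dk]; rewrite /area.
case: pselect => [h|[]]; last by exists k; apply/asboolP.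
by case: ex_minnP => m /asboolP dm minm; split=> // n dn; apply/minm/asboolP.
Qed.

End Dehn.

Definition dominated (f g : nat -> nat) : Prop :=
  exists2 C, 0 < C & forall n, f n <= C * g (C * n + C) + C * n + C.

Definition dehn_equiv (f g : nat -> nat) : Prop :=
  dominated f g /\ dominated g f.

Inductive stallings_gen : Type := Sa | Sb | Sc | Sd | Ss.

Definition stallings_gen_to_ord (x : stallings_gen) : 'I_5 :=
  match x with
  | Sa => inord 0 | Sb => inord 1 | Sc => inord 2 | Sd => inord 3 | Ss => inord 4
  end.

Definition stallings_gen_of_ord (i : 'I_5) : stallings_gen :=
  nth Ss [:: Sa; Sb; Sc; Sd; Ss] i.

Lemma stallings_gen_to_ordK : cancel stallings_gen_to_ord stallings_gen_of_ord.
Proof. by case; rewrite /stallings_gen_of_ord /= inordK. Qed.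

HB.instance Definition _ :=
  Finite.copy stallings_gen (can_type stallings_gen_to_ordK).

Definition stallings : finpres :=
  let gen x : word stallings_gen := [:: (x, false)] in
  let a := gen Sa in let b := gen Sb in let c := gen Sc in
  let d := gen Sd in let s := gen Ss in
  let eqn u v := u ++ word_inv v in
  FinPres [:: word_comm a c; word_comm a d; word_comm b c; word_comm b d;
              eqn (word_conj s a) (word_conj s b);
              eqn (word_conj s a) (word_conj s c);
              eqn (word_conj s a) (word_conj s d);
              eqn (word_conj s b) (word_conj s c);
              eqn (word_conj s b) (word_conj s d);
              eqn (word_conj s c) (word_conj s d)].

(* Main.v *)
(* Upper bound.  S embeds in F(a,b) x F(c,d) x F(t,s), where a, b, c, d all have
   third coordinate t.  A word w = w(a,b,c,d,s) has the normal form
     w(a,b,1,1,1) . w(1,1,c,d,1) . a^{-h} . w(a,a,a,a,s),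
   h being the exponent sum of a, b, c, d, and w = 1 in S iff all these words
   are freely trivial.  Multiplying two normal forms of length O(n) costs O(n^2):
   a word rho(a,s) of a-exponent 0 commutes with words in c a^-1, d a^-1 letter by
   letter, and since a = (a c^-1) c with a c^-1 commuting with c and s, it can be
   rewritten as rho(c,s), which commutes with words in a c^-1, b c^-1.  Bisecting w
   then gives A(n) <= 2 A(n/2) + O(n^2) for the cost of reaching the normal form.

   Lower bound.  Lift the map S -> Z^2 recording the exponents of a and c to the
   Heisenberg group on words; the relators become central of bounded height,
   while [a^n, c^n] has height n^2. *)
From Stdlib Require Import Setoid Morphisms.
From HB Require Import structures.
Require Import Defs.
From mathcomp Require Import all_boot all_order all_algebra.
From mathcomp Require Import boolp.
From mathcomp Require Import zify ring.

Set Implicit Arguments.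
Unset Strict Implicit.
Unset Printing Implicit Defensive.

(** * Substitution of words for generators *)

Section Substitution.
Variables A B : Type.
Implicit Types (f g : A -> word B) (l : letter A) (u v w : word A).

Definition lsub f l : word B := if l.2 then word_inv (f l.1) else f l.1.
Definition wsub f w : word B := flatten (map (lsub f) w).

Lemma wsub_cons f l w : wsub f (l :: w) = lsub f l ++ wsub f w.
Proof. by []. Qed.

Lemma wsub_cat f u v : wsub f (u ++ v) = wsub f u ++ wsub f v.
Proof. by rewrite /wsub map_cat flatten_cat. Qed.

Lemma wsub_nil w : wsub (fun=> [::]) w = [::].
Proof. by elim: w => // -[x []] w IHw; rewrite wsub_cons IHw. Qed.

Lemma lsub_inv f l : lsub f (letter_inv l) = word_inv (lsub f l).
Proof. by case: l => x [] //=; rewrite /lsub /= word_invK. Qed.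

Lemma wsub_inv f w : wsub f (word_inv w) = word_inv (wsub f w).
Proof.
elim: w => [|l w IHw] //.
rewrite word_inv_cons wsub_cat IHw !wsub_cons word_inv_cat -lsub_inv.
by rewrite /wsub /= cats0.
Qed.

Lemma size_word_inv (w : word B) : size (word_inv w) = size w.
Proof. by rewrite /word_inv size_rev size_map. Qed.

End Substitution.

Lemma size_wsub_le (A : finType) (B : Type) (f : A -> word B) :
  exists K, forall w, size (wsub f w) <= K * size w.
Proof.
exists (\max_x size (f x)); elim=> [|l w IHw] //.
rewrite wsub_cons size_cat mulnS leq_add //.
by apply: leq_trans (leq_bigmax l.1); case: l => x []; rewrite /= ?size_word_inv.
Qed.

Lemma wsub_wsub (A B C : Type) (f : A -> word B) (g : B -> word C) w :
  wsub g (wsub f w) = wsub (fun x => wsub g (f x)) w.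
Proof.
elim: w => [|[x e] w IHw] //; rewrite !wsub_cons wsub_cat IHw; congr (_ ++ _).
by case: e; rewrite /lsub //= wsub_inv.
Qed.

(** * Derivations of bounded cost *)

Section BoundedDerivations.
Variable P : finpres.
Implicit Types (u v w : word P) (N M : nat).

Lemma pres_classM u v : pres_class (u ++ v) = (pres_class u * pres_class v)%g.
Proof. exact: pres_class_cat. Qed.

Lemma pres_class_inv w : pres_class (word_inv w) = (pres_class w)^-1%g.
Proof.
apply: (mulIg (pres_class w)); rewrite mulVg -pres_classM.
by have /pres_classP := pres_eq_mulV (word_inv w); rewrite word_invK.
Qed.

Lemma pres_class_lsub (A : Type) (f : A -> word P) l :
  pres_class (lsub f l) =
  if l.2 then (pres_class (f l.1))^-1%g else pres_class (f l.1).
Proof. by case: l => x [] //; exact: pres_class_inv. Qed.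

Definition der_le N u v := exists2 n, n <= N & derives u v n.

Lemma der_le_refl N u : der_le N u u.
Proof. by exists 0 => //; exact: derives_refl. Qed.

Lemma der_le_mono N M u v : N <= M -> der_le N u v -> der_le M u v.
Proof. by move=> NM [n nN d]; exists n => //; exact: leq_trans NM. Qed.

Lemma der_le_sym N u v : der_le N u v -> der_le N v u.
Proof. by move=> [n nN d]; exists n => //; exact: derives_sym. Qed.

Lemma der_le_trans v N M u w :
  der_le N u v -> der_le M v w -> der_le (N + M) u w.
Proof.
by move=> [n nN d] [m mM e]; exists (n + m); [exact: leq_add | exact: derives_trans e].
Qed.

Lemma der_le_cat N M u u' v v' :
  der_le N u u' -> der_le M v v' -> der_le (N + M) (u ++ v) (u' ++ v').
Proof.
move=> [n nN d] [m mM e]; exists (n + m); first exact: leq_add.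
apply: (@derives_trans _ _ (u' ++ v)); first exact: (derives_cat [::] v d).
by have := derives_cat u' [::] e; rewrite !cats0.
Qed.

Lemma der_le_cat2l w N u v : der_le N u v -> der_le N (w ++ u) (w ++ v).
Proof. by move=> d; rewrite -[N]add0n; apply: der_le_cat d; exact: der_le_refl. Qed.

Lemma der_le_cat2r w N u v : der_le N u v -> der_le N (u ++ w) (v ++ w).
Proof.
by move=> d; rewrite -[N]addn0; apply: (der_le_cat d); exact: der_le_refl.
Qed.

Lemma der_le_mulV w : der_le 0 (w ++ word_inv w) [::].
Proof.
elim: w => [|l w IHw]; first exact: der_le_refl.
rewrite word_inv_cons -cat1s -catA (catA w).
apply: (@der_le_trans ([:: l] ++ [::] ++ [:: letter_inv l]) 0 0).
  exact/der_le_cat2l/der_le_cat2r.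
exists 0 => //; apply: derives_reduce (derives_refl _).
exact: (FreeReduction [::] [::] l).
Qed.

Lemma der_le_Vmul w : der_le 0 (word_inv w ++ w) [::].
Proof. by have := der_le_mulV (word_inv w); rewrite word_invK. Qed.

Lemma der_le_class u v :
  pres_class u = pres_class v -> exists N, der_le N u v.
Proof. by move=> /pres_classP/pres_eq_derives[n d]; exists n; exists n. Qed.

(** A maximum over the finite index type gives one bound for all instances. The cost constants of
    the upper bound come from here. *)
Lemma der_le_class_fin (I : finType) (F G : I -> word P) :
  (forall i, pres_class (F i) = pres_class (G i)) ->
  exists N, forall i, der_le N (F i) (G i).
Proof.
move=> FG; have /choice[N dN] : forall i, exists N, der_le N (F i) (G i).
  by move=> i; exact: der_le_class.
exists (\max_i N i) => i; apply: der_le_mono (dN i); exact: leq_bigmax.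
Qed.

Lemma area_le N w : represents_one w -> der_le N w [::] -> area w <= N.
Proof. by move=> /areaP[_ min] [n nN d]; exact: leq_trans (min n d) nN. Qed.

Lemma area_le_dehn n w : size w <= n -> represents_one w -> area w <= dehn P n.
Proof.
move=> wn w1.
apply: leq_trans (@leq_bigmax _ _ (Ordinal (n := n.+1) (m := size w) wn)) => /=.
by rewrite (bigmax_sup (in_tuple w)) //; apply/asboolP.
Qed.

Lemma dehn_le n N :
  (forall w, size w <= n -> represents_one w -> area w <= N) -> dehn P n <= N.
Proof.
move=> H; apply/bigmax_leqP => m _; apply/bigmax_leqP => w /asboolP w1.
by apply: H => //; rewrite size_tuple -ltnS.
Qed.

End BoundedDerivations.

(** * Commuting and merging substituted words *)

Section CommutingSubstitutions.
Variables (P : finpres) (A : finType).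
Implicit Types (f g h : A -> word P) (u v w : word A).

(** Each of the [size u * size v] exchanges of two letter images has bounded cost, as there are
    finitely many pairs of letters. *)
Lemma wsub_swap f g :
  (forall x y, commute (pres_class (f x)) (pres_class (g y))) ->
  exists K, forall u v,
    der_le (K * (size u * size v)) (wsub f u ++ wsub g v) (wsub g v ++ wsub f u).
Proof.
move=> fg.
pose F (i : (A * bool) * (A * bool)) := lsub f i.1 ++ lsub g i.2.
pose G (i : (A * bool) * (A * bool)) := lsub g i.2 ++ lsub f i.1.
have [|K dK] := @der_le_class_fin P _ F G.
  move=> [[x e] [y e']]; rewrite /F /G /= !pres_classM !pres_class_lsub /=.
  case: e; case: e'; first [exact: fg | exact: commuteV | idtac].
  - by apply: commute_sym; apply: commuteV; apply: commute_sym; apply: commuteV.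
  - by apply: commute_sym; apply: commuteV; apply: commute_sym.
exists K; elim=> [|l u IHu] v; first by rewrite /= cats0; exact: der_le_refl.
have {}IHu := IHu v.
(* A single letter image is first moved across the whole of [wsub g v]. *)
have dl : der_le (K * size v) (lsub f l ++ wsub g v) (wsub g v ++ lsub f l).
  elim: v {IHu} => [|m v IHv]; first by rewrite /= cats0; exact: der_le_refl.
  rewrite wsub_cons catA mulnS.
  apply: der_le_trans (der_le_cat2r _ (dK (l, m))) _.
  by rewrite /G /= -!catA; exact: der_le_cat2l.
rewrite wsub_cons -catA mulSn mulnDr addnC.
apply: der_le_trans (der_le_cat2l _ IHu) _.
by rewrite !catA; exact: der_le_cat2r.
Qed.

Lemma wsub_class f h : (forall x, pres_class (f x) = pres_class (h x)) ->
  exists K, forall w, der_le (K * size w) (wsub f w) (wsub h w).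
Proof.
move=> fh.
have [|K dK] := @der_le_class_fin P (A * bool)%type (lsub f) (lsub h).
  by move=> l; rewrite !pres_class_lsub fh.
exists K; elim=> [|l w IHw]; first exact: der_le_refl.
by rewrite !wsub_cons mulnS; exact: der_le_cat.
Qed.

(** By induction on [w]: the image of the head letter under [g] moves left across [wsub f w] at
    linear cost and merges with its image under [f]. The linear costs add up to a quadratic one. *)
Lemma wsub_merge f g h :
  (forall x y, commute (pres_class (f x)) (pres_class (g y))) ->
  (forall x, pres_class (f x ++ g x) = pres_class (h x)) ->
  exists K, forall w,
    der_le (K * size w ^ 2) (wsub f w ++ wsub g w) (wsub h w).
Proof.
move=> fg fgh; have [K1 d1] := wsub_swap fg.
have [|K2 d2] := @der_le_class_fin P (A * bool)%type
    (fun l => lsub f l ++ lsub g l) (lsub h).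
  move=> [x e]; rewrite pres_classM !pres_class_lsub /= -fgh pres_classM.
  (* For an inverse letter the factors of the inverse come in the opposite order, which commutation
     repairs. *)
  by case: e => //; rewrite fg invgM.
exists (K1 + K2); elim=> [|l w IHw]; first exact: der_le_refl.
apply: (@der_le_mono _ (K1 * size w + (K2 + (K1 + K2) * size w ^ 2))).
  by rewrite /=; nia.
rewrite !wsub_cons -catA.
have {d1} := d1 w [:: l]; rewrite muln1 /wsub /= cats0 -!/(wsub _ _) => d1.
apply: (@der_le_trans _ (lsub f l ++ lsub g l ++ wsub f w ++ wsub g w)).
  by apply: der_le_cat2l; rewrite !catA; exact: der_le_cat2r.
by rewrite catA; exact: der_le_cat.
Qed.

End CommutingSubstitutions.

(** * Images of derivations and change of presentation *)

Section FreeManipulations.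
Variable P : finpres.

Lemma der_le_inv N (u : word P) : der_le N u [::] -> der_le N (word_inv u) [::].
Proof.
move=> d; rewrite -[N]addn0; apply: (@der_le_trans _ (word_inv u ++ u)).
  by rewrite -[X in der_le _ X]cats0; exact/der_le_cat2l/der_le_sym.
exact: der_le_Vmul.
Qed.

(** A rotation is a conjugate: for [w = x ++ y], free expansion turns [w] into
    [x ++ (y ++ x) ++ word_inv x]. *)
Lemma der_le_rot N k (w : word P) :
  der_le N (rot k w) [::] -> der_le N w [::].
Proof.
rewrite /rot -[X in _ -> der_le _ X _](cat_take_drop k).
move: (take k w) (drop k w) => x y d.
rewrite -[N]add0n; apply: (@der_le_trans _ ((x ++ y) ++ x ++ word_inv x)).
  apply: der_le_sym; rewrite -[X in der_le _ _ X]cats0.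
  by apply: der_le_cat2l; exact: der_le_mulV.
rewrite -[N]addn0; apply: (@der_le_trans _ (x ++ word_inv x)); last exact: der_le_mulV.
by rewrite -catA (catA y); apply: der_le_cat2l; exact: (der_le_cat2r _ d).
Qed.

Lemma der_le_divr N (u v : word P) :
  der_le N (u ++ word_inv v) [::] -> der_le N u v.
Proof.
move=> d; rewrite -[N]add0n; apply: (@der_le_trans _ (u ++ word_inv v ++ v)).
  apply: der_le_sym; rewrite -[X in der_le _ _ X]cats0.
  by apply: der_le_cat2l; exact: der_le_Vmul.
by rewrite catA; exact: (der_le_cat2r _ d).
Qed.

End FreeManipulations.

Section Transfer.
Variables P Q : finpres.

(** Free moves stay free, and the image of each relator is filled once and for all at cost at most
    [K]; so every relator move becomes a derivation of cost at most [K]. *)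
Lemma der_le_wsub (F : P -> word Q) :
  (forall r, r \in rels P -> represents_one (wsub F r)) ->
  exists K, forall n u v, der_le n u v -> der_le (K * n) (wsub F u) (wsub F v).
Proof.
move=> F1.
have [|K dK] := @der_le_class_fin Q 'I_(size (rels P))
    (fun i => wsub F (nth [::] (rels P) i)) (fun=> [::]).
  by move=> i; apply: F1; exact: mem_nth.
have {}dK r : relator_or_inverse r -> der_le K (wsub F r) [::].
  have relK s : s \in rels P -> der_le K (wsub F s) [::].
    by move=> /(nthP [::])[i lti <-]; exact: (dK (Ordinal lti)).
  case=> [|/relK]; first exact: relK.
  by rewrite wsub_inv => /der_le_inv; rewrite word_invK.
have free u v : free_reduction u v -> der_le 0 (wsub F u) (wsub F v).
  case=> x y l; rewrite !wsub_cat; apply: der_le_cat2l.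
  apply: (der_le_cat2r (wsub F y) (v := [::])).
  rewrite /wsub /= cats0 lsub_inv; exact: der_le_mulV.
exists K => n u v [m mn d]; apply: der_le_mono (_ : K * m <= _) _.
  by rewrite leq_mul2l mn orbT.
elim: d => {n u v m mn}.
- by move=> w; exact: der_le_refl.
- by move=> u v w n /free uv _ vw; rewrite -[K * n]add0n; exact: der_le_trans vw.
- move=> u v w n /free/der_le_sym uv _ vw.
  by rewrite -[K * n]add0n; exact: der_le_trans vw.
- move=> u v w n uv _ vw; rewrite mulnS; apply: der_le_trans vw.
  case: uv => x y u' v' k /dK; rewrite /rot !wsub_cat => d.
  apply/der_le_cat2l/der_le_cat2r/der_le_divr.
  rewrite -wsub_inv -wsub_cat.
  (* Rotating a word by [k] letters rotates its image by the length of the image of its first [k]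
     letters. *)
  apply: (@der_le_rot _ _ (size (wsub F (take k (u' ++ word_inv v'))))).
  rewrite -[X in rot _ (wsub _ X)](cat_take_drop k) wsub_cat rot_size_cat.
  exact: d.
Qed.

Lemma pres_class_wsub (f : pres_group P -> pres_group Q) (F : P -> word Q) :
  {morph f : x y / (x * y)%g} ->
  (forall x, pres_class (F x) = f (pres_class [:: (x, false)])) ->
  forall w, pres_class (wsub F w) = f (pres_class w).
Proof.
move=> fM fF.
have f1 : f 1%g = 1%g by apply: (mulIg (f 1%g)); rewrite -fM !mul1g.
have fV x : f x^-1%g = (f x)^-1%g by apply: (mulIg (f x)); rewrite -fM !mulVg.
elim=> [|l w IHw]; first exact/esym/f1.
rewrite wsub_cons -[l :: w]cat1s !pres_classM fM IHw; congr (_ * _)%g.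
by rewrite pres_class_lsub fF; case: l => x [] //=; rewrite -fV -pres_class_inv.
Qed.

(** A homomorphism becomes a substitution once a representative is chosen for the image of each
    generator. *)
Definition hom_word (f : pres_group P -> pres_group Q) (x : P) : word Q :=
  pres_repr (f (pres_class [:: (x, false)])).

Lemma pres_class_hom_word (f : pres_group P -> pres_group Q) :
  {morph f : x y / (x * y)%g} ->
  forall w, pres_class (wsub (hom_word f) w) = f (pres_class w).
Proof. by move=> fM; apply: pres_class_wsub => // x; exact: pres_reprK. Qed.

End Transfer.

(* A loop is pushed to [Q], filled there and pulled back; the linear term is the
   cost of returning from the pulled back loop to the original one. *)
Lemma quadratic_transfer (P Q : finpres) :
  isomorphic (pres_group P) (pres_group Q) ->
  (exists K, forall w : word Q, represents_one w -> der_le (K * size w ^ 2) w [::]) ->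
  exists K, forall w : word P, represents_one w ->
    der_le (K * (size w ^ 2 + size w)) w [::].
Proof.
move=> [f [g fK gK]] [K fillQ].
have fM : {morph f : x y / (x * y)%g} by exact: gmulfM.
have gM : {morph g : x y / (x * y)%g} by exact: can2_gmulfM fK gK.
have clF := pres_class_hom_word fM; have clG := pres_class_hom_word gM.
set F := hom_word f in clF; set G := hom_word g in clG.
have [L sizeF] := size_wsub_le F.
have [|M derG] := @der_le_wsub Q P G.
  move=> r rQ; rewrite /represents_one clG.
  have -> : pres_class r = 1%g by apply/pres_classP; exact: pres_eq_rel.
  by apply: (mulIg (g 1%g)); rewrite -gM !mul1g.
have [|N derGF] := @wsub_class P P (fun x => wsub G (F x)) (fun x => [:: (x, false)]).
  by move=> x; rewrite clG pres_reprK fK.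
have wsub_id (w : word P) : wsub (fun x => [:: (x, false)]) w = w.
  by elim: w => // -[x []] w IHw; rewrite wsub_cons IHw.
exists (N + M * (K * L ^ 2)) => w w1.
have Fw1 : represents_one (wsub F w).
  rewrite /represents_one clF w1.
  by apply: (mulIg (f 1%g)); rewrite -fM !mul1g.
apply: der_le_mono (_ : N * size w + M * (K * size (wsub F w) ^ 2) <= _) _.
  have := sizeF w; move: (size (wsub F w)) (size w) => m n mLn.
  have : m ^ 2 <= (L * n) ^ 2 by rewrite leq_sqr.
  rewrite expnMn; move: (m ^ 2) (L ^ 2) (n ^ 2) => m' l n' /(leq_mul (leqnn (M * K))).
  by nia.
apply: der_le_trans (derG _ _ [::] (fillQ _ Fw1)).
by apply: der_le_sym; rewrite wsub_wsub -[X in der_le _ _ X]wsub_id.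
Qed.

(** * Free equality of words *)

Lemma der_le0_class (P : finpres) (u v : word P) :
  der_le 0 u v -> pres_class u = pres_class v.
Proof.
case=> n; rewrite leqn0 => /eqP n0 d; elim: d n0 => // {n u v}.
- move=> u v w n [x y l] _ IH /IH <-; rewrite !pres_classM.
  by rewrite -[[:: l; _]]cat1s pres_classM (pres_class_inv [:: l]) mulgV mul1g.
- move=> u v w n [x y l] _ IH /IH <-; rewrite !pres_classM.
  by rewrite -[[:: l; _]]cat1s pres_classM (pres_class_inv [:: l]) mulgV mul1g.
Qed.

Section FreeReduction.
Variables (P : finpres) (eqb : rel P).
Hypothesis eqbW : forall x y, eqb x y -> x = y.

(** Left multiplication of a reduced word by a letter; folding it over a word performs free
    reduction. *)
Definition push_letter (l : letter P) (w : word P) : word P :=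
  if w is m :: w' then if eqb l.1 m.1 && (l.2 != m.2) then w' else l :: w
  else [:: l].

Lemma der_le_foldr_push (w : word P) : der_le 0 w (foldr push_letter [::] w).
Proof.
elim: w => [|l w IHw]; first exact: der_le_refl.
apply: (@der_le_trans _ (l :: foldr push_letter [::] w) 0 0).
  exact: (der_le_cat2l [:: l] IHw).
rewrite /=; case: (foldr _ _ _) => [|m v]; first exact: der_le_refl.
rewrite /push_letter; case: ifP => [/andP[/eqbW lm1 lm2]|_]; last exact: der_le_refl.
have -> : m = letter_inv l.
  by case: l m lm1 lm2 => x [] [y []] //= ->.
apply: (der_le_cat2r v (u := [:: l; letter_inv l]) (v := [::])).
rewrite -cat1s; exact: (der_le_mulV [:: l]).
Qed.

End FreeReduction.

(** * Families of words up to quadratic cost *)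

Section QuadraticEquivalence.
Variables (P : finpres) (T : Type) (size_of : T -> nat).
Implicit Types F G H : T -> word P.

(** As an equivalence compatible with concatenation, this relation supports setoid rewriting, which
    keeps the constants implicit. *)
Definition qeq F G := exists K, forall t, der_le (K * size_of t ^ 2) (F t) (G t).
Definition fcat F G t := F t ++ G t.

#[global] Instance qeq_equiv : Equivalence qeq.
Proof.
split=> [F|F G [K d]|F G H [K d] [L e]].
- by exists 0 => t; exact: der_le_refl.
- by exists K => t; exact: der_le_sym.
- by exists (K + L) => t; rewrite mulnDl; exact: der_le_trans (e t).
Qed.

#[global] Instance fcat_qeq : Proper (qeq ==> qeq ==> qeq) fcat.
Proof.
move=> F F' [K d] G G' [L e].
by exists (K + L) => t; rewrite mulnDl; exact: der_le_cat.
Qed.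

Lemma fcatA F G H : fcat F (fcat G H) = fcat (fcat F G) H.
Proof. by apply/funext => t; exact: catA. Qed.

Definition qcomm F G := qeq (fcat F G) (fcat G F).

Lemma qcommM F G H : qcomm F G -> qcomm F H -> qcomm F (fcat G H).
Proof. rewrite /qcomm => FG FH; rewrite fcatA FG -fcatA FH fcatA; reflexivity. Qed.

Lemma qcomm_sym F G : qcomm F G -> qcomm G F.
Proof. by rewrite /qcomm => FG; symmetry. Qed.

End QuadraticEquivalence.
Local Infix "+++" := fcat (at level 61, right associativity).
Arguments qeq {P T} size_of F G.

(** The recursion of the bisection, solved by [4 * K * m ^ 2]: the halves contribute about
    [2 * K * m ^ 2], which leaves room for [K * m ^ 2]. For odd [m] the rounding is absorbed because
    [k] is positive. *)
Lemma bisection_arith K m k : 0 < k -> k.*2 <= m <= k.*2.+1 ->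
  4 * K * k ^ 2 + 4 * K * (m - k) ^ 2 + K * m ^ 2 <= 4 * K * m ^ 2.
Proof.
move=> k0 km.
have -> : m = k + (m - k) by lia.
have mk : m - k = k \/ m - k = k.+1 by lia.
have E x : 4 * K * x = K * (4 * x) by rewrite mulnCA mulnA.
rewrite !E -!mulnDr leq_mul2l addKn; apply/orP; right.
by case: mk => ->; nia.
Qed.

(** * Commutation in Stallings' group *)

Section Stallings.
Local Notation S := stallings.
Implicit Types (f g h : S -> word S) (x y : S).

Local Notation gen x := ([:: (x, false)] : word S).
Local Notation ginv x := ([:: (x, true)] : word S).
Local Notation cl w := (pres_class (w : word S)).

Lemma class_gen_inv x : cl (ginv x) = ((cl (gen x))^-1)%g.
Proof. by rewrite -pres_class_inv. Qed.

Definition gens_ab (w : S -> word S) x : word S :=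
  if x is (Sa | Sb) then w x else [::].
Definition gens_cd (w : S -> word S) x : word S :=
  if x is (Sc | Sd) then w x else [::].
Definition gens_abcd (w : S -> word S) x : word S :=
  if x is Ss then [::] else w x.
(** With [z] in the role of t, this is the projection to the third factor F(t,s). *)
Definition collapse z x : word S := if x is Ss then gen Ss else gen z.

Lemma class_rels i : i < 10 -> cl (nth [::] (rels S) i) = 1%g.
Proof. by move=> i10; apply/pres_classP/pres_eq_rel; exact: mem_nth. Qed.

Lemma commute_word_comm x y :
  cl (word_comm (gen x) (gen y)) = 1%g -> commute (cl (gen x)) (cl (gen y)).
Proof.
rewrite /word_comm !pres_classM !pres_class_inv => e.
apply: (mulgI (cl (gen y))^-1%g); apply: (mulgI (cl (gen x))^-1%g).
by rewrite e mulKg mulVg.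
Qed.

Lemma conj_s x : x <> Ss ->
  cl (word_conj (gen Ss) (gen x)) = cl (word_conj (gen Ss) (gen Sa)).
Proof.
have eqn u v : cl (u ++ word_inv v) = 1%g -> cl v = cl u.
  by rewrite pres_classM pres_class_inv => /divg1_eq.
case: x => // _; apply: eqn.
- exact: (@class_rels 4).
- exact: (@class_rels 5).
- exact: (@class_rels 6).
Qed.

Lemma comm_s x y : x <> Ss -> y <> Ss ->
  commute (cl (gen Ss)) (cl (gen x ++ ginv y)).
Proof.
move=> xs ys; have := etrans (conj_s xs) (esym (conj_s ys)).
rewrite /word_conj !pres_classM !pres_class_inv => e.
apply: (mulIg (cl (gen y))); apply: (mulgI (cl (gen x))^-1%g).
by rewrite !mulgA mulgVK mulVg mul1g -!mulgA e.
Qed.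

Definition letters_commute (l m : letter S) : bool :=
  match l.1, m.1 with
  | (Sa | Sb), (Sc | Sd) | (Sc | Sd), (Sa | Sb) => true
  | Sa, Sa | Sb, Sb | Sc, Sc | Sd, Sd | Ss, Ss => true
  | _, _ => false
  end.

Definition is_s x : bool := if x is Ss then true else false.

(* For x, y <> s, the relation s^x = s^y says that s commutes with x y^-1. *)
Definition commutes_with_s (u v : word S) : bool :=
  match u, v with
  | [:: (z, false)], [:: (x, false); (y, true)] => [&& is_s z, ~~ is_s x & ~~ is_s y]
  | _, _ => false
  end.

(** A sufficient test that computes, so that commutation of the images of generators is checked by
    enumeration. *)
Definition words_commute (u v : word S) : bool :=
  [|| all (fun l => all (letters_commute l) v) u, commutes_with_s u v
    | commutes_with_s v u].

Lemma letters_commuteP l m : letters_commute l m -> commute (cl [:: l]) (cl [:: m]).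
Proof.
have inv (w : word S) x e : commute (cl w) (cl (gen x)) -> commute (cl w) (cl [:: (x, e)]).
  by case: e => //; rewrite class_gen_inv; exact: commuteV.
case: l m => x e [y e'] lm; apply/inv/commute_sym/inv.
move: lm; rewrite /letters_commute /= => {e e'}.
have ac := commute_word_comm (@class_rels 0 isT).
have ad := commute_word_comm (@class_rels 1 isT).
have bc := commute_word_comm (@class_rels 2 isT).
have bd := commute_word_comm (@class_rels 3 isT).
by case: x; case: y => // _; apply: commute_sym.
Qed.

Lemma commutes_with_sP u v : commutes_with_s u v -> commute (cl u) (cl v).
Proof.
case: u => [|[z []] []] //; case: v => [|[x []] [|[y []] []]] //= /and3P[zs xs ys].
have -> : z = Ss by case: z zs.
by apply: comm_s => [xE|yE]; [move: xs; rewrite xE | move: ys; rewrite yE].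
Qed.

Lemma words_commuteP u v : words_commute u v -> commute (cl u) (cl v).
Proof.
case/or3P=> [|/commutes_with_sP//|/commutes_with_sP/commute_sym//].
elim: u => [_|l u IHu /= /andP[lv /IHu uv]]; first exact/commute_sym/commute1.
rewrite -cat1s pres_classM; apply/commute_sym/commuteM; last exact: commute_sym.
elim: v lv {uv IHu} => [_|m v IHv /= /andP[lm /IHv vl]]; first exact/commute_sym/commute1.
rewrite -[m :: v]cat1s pres_classM; apply/commute_sym/commuteM; last exact: commute_sym.
exact: letters_commuteP.
Qed.

(* The [eqType] structure of the generators goes through [inord] and does not
   compute, hence this comparison by pattern matching. *)
Definition gen_eqb x y : bool :=
  match x, y with
  | Sa, Sa | Sb, Sb | Sc, Sc | Sd, Sd | Ss, Ss => true
  | _, _ => false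
  end.

Lemma gen_eqbW x y : gen_eqb x y -> x = y.
Proof. by case: x; case: y. Qed.

Definition freduce (w : word S) : word S := foldr (push_letter gen_eqb) [::] w.

Lemma der_le_freduce u v : freduce u = freduce v -> der_le 0 u v.
Proof.
move=> uv; apply: (@der_le_trans _ (freduce u) 0 0).
  exact: der_le_foldr_push gen_eqbW _.
rewrite uv; apply: der_le_sym; exact: der_le_foldr_push gen_eqbW _.
Qed.

Local Notation T := (word S * word S)%type.
Local Notation size2 := (fun t : T => size t.1 + size t.2).
Local Notation "F ~~~ G" := (qeq size2 F G) (at level 70).

(** Families are indexed by pairs of words because two normal forms are to be multiplied; the
    boolean selects the factor. *)
Definition coord (b : bool) (t : T) := if b then t.2 else t.1.
Definition sub_at b f (t : T) := wsub f (coord b t).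

Lemma sub_at_merge b f g h :
  (forall x y, words_commute (f x) (g y)) ->
  (forall x, freduce (f x ++ g x) = freduce (h x)) ->
  sub_at b f +++ sub_at b g ~~~ sub_at b h.
Proof.
move=> fg fgh.
have [||K dK] := @wsub_merge S _ f g h.
- by move=> x y; exact: words_commuteP.
- by move=> x; apply: der_le0_class; exact: der_le_freduce.
exists K => t; apply: der_le_mono (dK _).
rewrite leq_mul2l leq_sqr /coord; case: ifP => _; lia.
Qed.

Lemma sub_at_comm b b' f g :
  (forall x y, words_commute (f x) (g y)) ->
  qcomm size2 (sub_at b f) (sub_at b' g).
Proof.
move=> fg; have [|K dK] := @wsub_swap S _ f g.
  by move=> x y; exact: words_commuteP.
exists K => t; apply: der_le_mono (dK _ _).
rewrite leq_mul2l /coord; case: b; case: b'; nia.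
Qed.

Local Ltac by_cases := by case; try case.

(** * Normal forms and their products *)

Let height_inv z := gens_abcd (fun=> ginv z).
(** The word z^{-h} w(z,z,z,z,s), of exponent sum 0 in [z]. It represents an element of the third
    factor, the same for [Sa] and [Sc]. *)
Let rho b z := sub_at b (height_inv z) +++ sub_at b (collapse z).

(** Use a^{-1} = c^{-1} (c a^{-1}) in the first factor and a = (a c^{-1}) c in the second, where a
    c^{-1} commutes with c and s. The resulting words in c a^{-1} and a c^{-1} meet in the middle
    and cancel. *)
Lemma rho_change b : rho b Sa ~~~ rho b Sc.
Proof.
have e1 : sub_at b (height_inv Sc) +++ sub_at b (gens_abcd (fun=> gen Sc ++ ginv Sa))
    ~~~ sub_at b (height_inv Sa) by apply: sub_at_merge; by_cases.
have e2 : sub_at b (gens_abcd (fun=> gen Sa ++ ginv Sc)) +++ sub_at b (collapse Sc)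
    ~~~ sub_at b (collapse Sa) by apply: sub_at_merge; by_cases.
have e3 : sub_at b (gens_abcd (fun=> gen Sc ++ ginv Sa)) +++
    sub_at b (gens_abcd (fun=> gen Sa ++ ginv Sc)) ~~~ sub_at b (fun=> [::]).
  by apply: sub_at_merge; by_cases.
rewrite /rho -e1 -e2 -fcatA (fcatA (sub_at b (gens_abcd _))) e3.
have -> F : sub_at b (fun=> [::]) +++ F = F.
  by apply/funext => t; rewrite /fcat /sub_at wsub_nil.
reflexivity.
Qed.


Let f_ab := gens_ab (fun x => gen x).
Let f_cd := gens_cd (fun x => gen x).

(** The normal form without its last factor. Its third coordinate is trivial, so it lies in F(a,b) x
    F(c,d) and commutes in S with every [rho]. *)
Let central b :=
  sub_at b f_ab +++ sub_at b f_cd +++ sub_at b (height_inv Sa).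

(** The power a^{-h} is shared out. The part due to c and d joins w(c,d); the part due to a and b is
    rewritten by a^{-1} = c^{-1} (c a^{-1}), and its power of c joins w(a,b). *)
Lemma central_split b :
  central b ~~~ sub_at b (gens_ab (fun x => gen x ++ ginv Sc)) +++
    sub_at b (gens_ab (fun=> gen Sc ++ ginv Sa)) +++
    sub_at b (gens_cd (fun x => gen x ++ ginv Sa)).
Proof.
have e1 : sub_at b (gens_ab (fun=> ginv Sa)) +++ sub_at b (gens_cd (fun=> ginv Sa))
    ~~~ sub_at b (height_inv Sa) by apply: sub_at_merge; by_cases.
have e2 : sub_at b (gens_ab (fun=> ginv Sc)) +++
    sub_at b (gens_ab (fun=> gen Sc ++ ginv Sa))
    ~~~ sub_at b (gens_ab (fun=> ginv Sa)) by apply: sub_at_merge; by_cases.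
have e3 : sub_at b f_ab +++ sub_at b (gens_ab (fun=> ginv Sc))
    ~~~ sub_at b (gens_ab (fun x => gen x ++ ginv Sc)).
  by apply: sub_at_merge; by_cases.
have e4 : sub_at b f_cd +++ sub_at b (gens_cd (fun=> ginv Sa))
    ~~~ sub_at b (gens_cd (fun x => gen x ++ ginv Sa)).
  by apply: sub_at_merge; by_cases.
have e5 : sub_at b f_cd +++ sub_at b (gens_ab (fun=> ginv Sa))
    ~~~ sub_at b (gens_ab (fun=> ginv Sa)) +++ sub_at b f_cd.
  by apply: sub_at_comm; by_cases.
rewrite /central -e1 (fcatA (sub_at b f_cd)) e5 -e2 -e3 -e4 -!fcatA.
reflexivity.
Qed.

(* In [central_split], the first factor commutes with c and s, the others with
   a and s. *)
Lemma rho_central_comm b b' : qcomm size2 (rho b Sa) (central b').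
Proof.
have shift f : (forall x y, words_commute (f x) (height_inv Sa y)) ->
    (forall x y, words_commute (f x) (collapse Sa y)) ->
    qcomm size2 (rho b Sa) (sub_at b' f).
  by move=> fh fc; apply/qcomm_sym/qcommM; exact: sub_at_comm.
rewrite /qcomm central_split -/(qcomm _ _ _); apply: qcommM; last apply: qcommM.
- rewrite /qcomm rho_change -/(qcomm _ _ _).
  by apply/qcomm_sym/qcommM; apply: sub_at_comm; by_cases.
- by apply: shift; by_cases.
- by apply: shift; by_cases.
Qed.

Definition normal_form (w : word S) : word S :=
  wsub f_ab w ++ wsub f_cd w ++ wsub (height_inv Sa) w ++ wsub (collapse Sa) w.

(** In the product, [rho] of the first word stands before [central] of the second. Once these are
    exchanged, only factors that commute letter by letter remain to be sorted. *)
Lemma normal_form_mul :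
  (fun t : T => normal_form t.1 ++ normal_form t.2) ~~~
  (fun t : T => normal_form (t.1 ++ t.2)).
Proof.
have -> : (fun t : T => normal_form t.1 ++ normal_form t.2) =
  sub_at false f_ab +++ sub_at false f_cd +++ rho false Sa +++ central true +++
  sub_at true (collapse Sa).
  apply/funext => t; rewrite /normal_form /rho /central /fcat /sub_at /=.
  by rewrite -!catA.
have -> : (fun t : T => normal_form (t.1 ++ t.2)) =
  sub_at false f_ab +++ sub_at true f_ab +++ sub_at false f_cd +++ sub_at true f_cd +++
  sub_at false (height_inv Sa) +++ sub_at true (height_inv Sa) +++
  sub_at false (collapse Sa) +++ sub_at true (collapse Sa).
  apply/funext => t; rewrite /normal_form /fcat /sub_at /= !wsub_cat.
  by rewrite -!catA.
have e1 : sub_at false f_cd +++ sub_at true f_ab ~~~ sub_at true f_ab +++ sub_at false f_cd.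
  by apply: sub_at_comm; by_cases.
have e2 : sub_at true (height_inv Sa) +++ sub_at false (height_inv Sa)
    ~~~ sub_at false (height_inv Sa) +++ sub_at true (height_inv Sa).
  by apply: sub_at_comm; by_cases.
have e3 : rho false Sa +++ central true ~~~ central true +++ rho false Sa.
  exact: rho_central_comm.
rewrite (fcatA (rho _ _)) e3 /central /rho -!fcatA.
rewrite (fcatA (sub_at false f_cd)) e1 -!fcatA.
rewrite (fcatA (sub_at true (height_inv Sa))) e2 -!fcatA.
reflexivity.
Qed.

Lemma normal_form_letter (l : letter S) : der_le 0 [:: l] (normal_form [:: l]).
Proof. by apply: der_le_freduce; case: l => [[] []]. Qed.

(** Strong induction on the length: both halves are brought to normal form and [normal_form_mul]
    joins the results. *)
Lemma der_le_normal_form :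
  exists K, forall w, der_le (K * size w ^ 2) w (normal_form w).
Proof.
have [K dK] := normal_form_mul; exists (4 * K) => w.
have [n] := ubnP (size w); elim: n w => // n IHn w.
(* The bisection needs a nonempty first half; a single letter is freely equal to its normal form. *)
rewrite ltnS => wn; have [w1|w1] := leqP (size w) 1.
  case: w w1 {wn} => [|l [|//]] _; first exact: der_le_refl.
  exact: der_le_mono (normal_form_letter l).
have szw : size (take (size w)./2 w) = (size w)./2 by rewrite size_takel; lia.
have szw' : size (drop (size w)./2 w) = size w - (size w)./2 by rewrite size_drop.
rewrite -[in X in der_le _ X _](cat_take_drop (size w)./2 w).
rewrite -[in X in der_le _ _ X](cat_take_drop (size w)./2 w).
have := dK (take (size w)./2 w, drop (size w)./2 w).
have := IHn (take (size w)./2 w); have := IHn (drop (size w)./2 w).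
rewrite /= szw szw' subnKC; last lia.
move: (take _ _) (drop _ _) => u v dv du duv.
apply: der_le_mono (_ : (4 * K * (size w)./2 ^ 2 + 4 * K * (size w - (size w)./2) ^ 2) + K * size w ^ 2 <= _) _.
  apply: bisection_arith; lia.
by apply: (der_le_trans (der_le_cat (du _) (dv _))) duv; lia.
Qed.

(** Such an [f] induces a homomorphism to a free group, free equality being derivability at cost
    0. *)
Lemma wsub_free f :
  (forall r, r \in rels S -> freduce (wsub f r) = [::]) ->
  forall u v, pres_eq u v -> der_le 0 (wsub f u) (wsub f v).
Proof.
move=> frel u v; elim=> {u v}.
- by move=> u; exact: der_le_refl.
- by move=> u v _; exact: der_le_sym.
- by move=> u v w _ uv _ vw; exact: (der_le_trans uv vw).
- by move=> u u' v v' _ uu _ vv; rewrite !wsub_cat; exact: (der_le_cat uu vv).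
- by move=> l; rewrite /wsub /= cats0 lsub_inv; exact: der_le_mulV.
- by move=> r /frel fr; apply: der_le_freduce; rewrite fr.
Qed.

(** Each of the four substitutions kills all relators freely, as computing their free reductions
    shows. *)
Lemma normal_form_trivial w : represents_one w -> der_le 0 (normal_form w) [::].
Proof.
move=> /pres_classP w1.
have by_rels f : all (fun r => nilp (freduce (wsub f r))) (rels S) ->
    der_le 0 (wsub f w) [::].
  by move=> /allP h; apply: (wsub_free _ w1) => r /h/nilP.
have d1 : der_le 0 (wsub f_ab w) [::] by exact: by_rels.
have d2 : der_le 0 (wsub f_cd w) [::] by exact: by_rels.
have d3 : der_le 0 (wsub (height_inv Sa) w) [::] by exact: by_rels.
have d4 : der_le 0 (wsub (collapse Sa) w) [::] by exact: by_rels.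
exact: (der_le_cat d1 (der_le_cat d2 (der_le_cat d3 d4))).
Qed.

Lemma stallings_quadratic_fill :
  exists K, forall w : word S, represents_one w -> der_le (K * size w ^ 2) w [::].
Proof.
have [K dK] := der_le_normal_form; exists K => w /normal_form_trivial w1.
by rewrite -[K * _]addn0; exact: (der_le_trans (dK w) w1).
Qed.

End Stallings.

(** * Upper bound for arbitrary presentations *)

Lemma dehn_upper (P : finpres) :
  isomorphic (pres_group P) (pres_group stallings) ->
  dominated (dehn P) (fun n => n ^ 2).
Proof.
move=> /quadratic_transfer/(_ stallings_quadratic_fill)[K fill].
(* The linear term of the filling bound goes into the term [C * n] of [dominated]. *)
exists K.+1 => // n; apply: dehn_le => w wn w1.
apply: leq_trans (area_le w1 (fill w w1)) _.
move: (size w) wn => m mn; have : m ^ 2 <= n ^ 2 by rewrite leq_sqr.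
have : n ^ 2 <= (K.+1 * n + K.+1) ^ 2 by rewrite leq_sqr; nia.
nia.
Qed.

(** * Heights in the Heisenberg group *)

Section HeisenbergCocycle.
Local Open Scope ring_scope.
Import GRing.Theory Num.Theory.
Variables (A : Type) (p q : A -> int).
Implicit Types (l : letter A) (u v w : word A).

Definition lexpo (p : A -> int) l : int := if l.2 then - p l.1 else p l.1.
Definition expo (p : A -> int) w : int := \sum_(l <- w) lexpo p l.

(* The central coordinate of the image of a word under x |-> (p x, q x, 0) in
   the Heisenberg group (x,y,z)(x',y',z') = (x+x', y+y', z+z'+xy'). *)
Fixpoint cocycle w : int :=
  if w is l :: w' then
    (if l.2 then p l.1 * q l.1 else 0) + cocycle w' + lexpo p l * expo q w'
  else 0.

Lemma expo_cons r l w : expo r (l :: w) = lexpo r l + expo r w.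
Proof. exact: big_cons. Qed.

Lemma expo_cat r u v : expo r (u ++ v) = expo r u + expo r v.
Proof. exact: big_cat. Qed.

Lemma lexpo_inv r l : lexpo r (letter_inv l) = - lexpo r l.
Proof. by case: l => x []; rewrite /lexpo /= ?opprK. Qed.

Lemma expo_inv r w : expo r (word_inv w) = - expo r w.
Proof.
elim: w => [|l w IHw]; first by rewrite /expo !big_nil oppr0.
rewrite word_inv_cons expo_cat IHw !expo_cons lexpo_inv /expo big_nil; ring.
Qed.

Lemma cocycle_cat u v : cocycle (u ++ v) = cocycle u + cocycle v + expo p u * expo q v.
Proof.
elim: u => [|l u IHu] /=; first by rewrite /expo big_nil; ring.
rewrite IHu expo_cat expo_cons; ring.
Qed.

Lemma cocycle_inv w : cocycle (word_inv w) = - cocycle w + expo p w * expo q w.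
Proof.
elim: w => [|l w IHw]; first by rewrite /expo !big_nil /=; ring.
rewrite word_inv_cons cocycle_cat IHw expo_inv !expo_cons lexpo_inv /=.
by rewrite /expo !big_nil; case: l => x []; rewrite /lexpo /=; ring.
Qed.

(** Commutators are central in the Heisenberg group, with the determinant of the exponent vectors as
    height; this is the source of the n^2. *)
Lemma cocycle_comm u v :
  cocycle (word_comm u v) = expo p u * expo q v - expo p v * expo q u.
Proof.
rewrite /word_comm !cocycle_cat !cocycle_inv !expo_cat !expo_inv; ring.
Qed.

End HeisenbergCocycle.

Lemma expo_wsub (A B : Type) (F : A -> word B) (r : B -> int) w :
  expo r (wsub F w) = expo (fun x => expo r (F x)) w.
Proof.
elim: w => [|l w IHw]; first by rewrite /expo !big_nil.
rewrite wsub_cons expo_cat expo_cons IHw; congr (_ + _)%R.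
by case: l => x []; rewrite /lsub /lexpo //= expo_inv.
Qed.

(** * Height as a lower bound for area *)

Section CocycleArea.
Local Open Scope ring_scope.
Import Order.TTheory GRing.Theory Num.Theory.
Variables (P : finpres) (p q : P -> int).
Implicit Types u v w : word P.

Lemma expo_pres_eq (r : P -> int) :
  (forall x, x \in rels P -> expo r x = 0) ->
  forall u v, pres_eq u v -> expo r u = expo r v.
Proof.
move=> r0 u v; elim=> {u v} // [u v w _ -> _ ->//|u u' v v' _ uu _ vv|l|x /r0 ->].
- by rewrite !expo_cat uu vv.
- by rewrite !expo_cons lexpo_inv /expo big_nil; ring.
- by rewrite /expo big_nil.
Qed.

Hypothesis p0 : forall x, x \in rels P -> expo p x = 0.
Hypothesis q0 : forall x, x \in rels P -> expo q x = 0.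

(** A sum of nonnegative terms bounds each of them, so it serves as a maximum over the relators. *)
Let M : int := \sum_(x <- rels P) `|cocycle p q x|.

Lemma cocycle_relator w :
  relator_or_inverse w ->
  [/\ expo p w = 0, expo q w = 0 & `|cocycle p q w| <= M].
Proof.
have rel x : x \in rels P -> [/\ expo p x = 0, expo q x = 0 & `|cocycle p q x| <= M].
  move=> xP; split; [exact: p0|exact: q0|].
  by rewrite /M (big_rem x) //= lerDl sumr_ge0.
case=> [/rel//|/rel[]]; rewrite !expo_inv cocycle_inv.
move=> /eqP; rewrite oppr_eq0 => /eqP pw /eqP; rewrite oppr_eq0 => /eqP qw.
by rewrite pw mul0r addr0 normrN.
Qed.

(** A word with both exponents zero maps to the centre, where conjugation acts trivially. *)
Lemma cocycle_rot k w : expo p w = 0 -> expo q w = 0 ->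
  cocycle p q (rot k w) = cocycle p q w.
Proof.
rewrite /rot -{1 2 5}(cat_take_drop k w) !expo_cat !cocycle_cat.
move=> /eqP; rewrite addr_eq0 => /eqP -> /eqP; rewrite addr_eq0 => /eqP ->; ring.
Qed.

Lemma expo_rot r k w : expo r (rot k w) = expo r w.
Proof. by rewrite /rot expo_cat addrC -expo_cat cat_take_drop. Qed.

Lemma cocycle_free_reduction u v :
  free_reduction u v -> cocycle p q u = cocycle p q v.
Proof.
case=> x y l; rewrite !cocycle_cat !expo_cat.
have -> : cocycle p q [:: l; letter_inv l] = 0.
  by case: l => z []; rewrite /= /lexpo /expo !big_cons big_nil /lexpo /=; ring.
have -> : expo q [:: l; letter_inv l] = 0.
  by rewrite !expo_cons lexpo_inv /expo big_nil; ring.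
have -> : expo p [:: l; letter_inv l] = 0.
  by rewrite !expo_cons lexpo_inv /expo big_nil; ring.
ring.
Qed.

(** The subwords exchanged by the move have equal exponents, so their images differ by a central
    element and the context does not affect the difference in height. *)
Lemma cocycle_relator_move u v :
  relator_move u v -> `|cocycle p q u - cocycle p q v| <= M.
Proof.
case=> x y u' v' k /cocycle_relator; rewrite !expo_rot => -[pw qw].
rewrite cocycle_rot // !cocycle_cat !expo_cat cocycle_inv expo_inv.
move: pw qw; rewrite !expo_cat !expo_inv => /subr0_eq -> /subr0_eq -> zM.
apply: le_trans zM; rewrite le_eqVlt; apply/orP; left; apply/eqP.
congr (`| _ |); ring.
Qed.

Lemma cocycle_derives u v n :
  derives u v n -> `|cocycle p q u - cocycle p q v| <= M *+ n.
Proof.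
elim=> {u v n}.
- by move=> w; rewrite subrr normr0 mulr0n.
- by move=> u v w n /cocycle_free_reduction ->.
- by move=> u v w n /cocycle_free_reduction ->.
- move=> u v w n /cocycle_relator_move uv _ vw; rewrite mulrS.
  by apply: le_trans (ler_distD (cocycle p q v) _ _) _; exact: lerD.
Qed.

(** Each relator move changes the height by at most [M], free moves preserve it, and the empty word
    has height 0. *)
Lemma cocycle_area : exists K : nat, forall w,
  represents_one w -> (`|cocycle p q w| <= K * area w)%N.
Proof.
exists `|M|%N => w /areaP[/cocycle_derives d _]; move: d.
rewrite [cocycle p q [::]]/= subr0 -mulr_natr.
have : 0 <= M by apply: sumr_ge0.
move: (cocycle p q w) => z; lia.
Qed.

End CocycleArea.

(** * Quadratic lower bound *)

Section LowerBound.
Variable P : finpres.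
Hypothesis PS : isomorphic (pres_group P) (pres_group stallings).

Let S := stallings.
Definition count_gen (x : S) : S -> int :=
  fun y => if gen_eqb x y then 1%R else 0%R.

(** The exponents of a and c are pulled back along [F] to the generators of [P]. The image under [G]
    of [a^n, c^n] then has height n^2 and length linear in n. *)
Lemma dehn_lower : dominated (fun n => n ^ 2) (dehn P).
Proof.
have [f [g fK gK]] := PS.
have fM : {morph f : x y / (x * y)%g} by exact: gmulfM.
have gM : {morph g : x y / (x * y)%g} by exact: can2_gmulfM fK gK.
have clF := pres_class_hom_word fM; have clG := pres_class_hom_word gM.
set F := hom_word f in clF; set G := hom_word g in clG.
pose p x := expo (count_gen Sa) (F x); pose q x := expo (count_gen Sc) (F x).
have expo_rel (z : S) : z = Sa \/ z = Sc ->
    forall r, r \in rels S -> expo (count_gen z) r = 0%R.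
  move=> zE r /(nthP [::])[i].
  (* One case for each of the ten relators. *)
  by case: zE => ->; do 10 (case: i => [_ <-|i] ; first by rewrite /expo unlock).
have expo_inv_class (z : S) : z = Sa \/ z = Sc -> forall u v : word S,
    pres_class u = pres_class v -> expo (count_gen z) u = expo (count_gen z) v.
  by move=> /expo_rel e u v /pres_classP; exact: expo_pres_eq.
have expo_relP (z : S) : z = Sa \/ z = Sc -> forall r, r \in rels P ->
    expo (fun x => expo (count_gen z) (F x)) r = 0%R.
  move=> zE r rP; rewrite -expo_wsub (expo_inv_class z zE _ [::]).
    by rewrite /expo big_nil.
  rewrite clF.
  have -> : pres_class r = pres_class [::] by apply/pres_classP; exact: pres_eq_rel.
  by rewrite -clF.
(* [F] after [G] is the identity on classes, so the exponents in S are recovered. *)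
have expo_G (z : S) (w : word S) : z = Sa \/ z = Sc ->
    expo (fun x => expo (count_gen z) (F x)) (wsub G w) = expo (count_gen z) w.
  by move=> zE; rewrite -expo_wsub; apply: expo_inv_class => //; rewrite clF clG gK.
have [K areaK] := cocycle_area (expo_relP Sa (or_introl erefl))
                               (expo_relP Sc (or_intror erefl)).
have [L sizeL] := size_wsub_le G.
pose pow x n : word S := nseq n (x, false).
have expo_pow (z x : S) n : expo (count_gen z) (pow x n) = (count_gen z x *+ n)%R.
  by elim: n => [|n IHn]; rewrite /expo ?big_nil // big_cons GRing.mulrS -IHn.
(* [4 * L * n] bounds the length of the image of [a^n, c^n], a word of length [4 * n]; [K] is the
   factor in front of the area. *)
exists (K + 4 * L).+1 => // n.
pose w : word S := word_comm (pow Sa n) (pow Sc n).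
have w1 : represents_one w.
  apply/pres_classP; rewrite /w /word_comm.
  have /pres_classP ac : pres_class (pow Sa n ++ pow Sc n) = pres_class (pow Sc n ++ pow Sa n).
    rewrite !pres_classM; apply: words_commuteP; rewrite /words_commute.
    by rewrite all_nseq /= all_nseq /= !orbT.
  apply: pres_eq_trans (_ : pres_eq (word_inv (pow Sa n) ++ word_inv (pow Sc n) ++ (pow Sc n ++ pow Sa n)) [::]).
    by do 2 (apply: pres_eq_cat; first exact: pres_eq_refl).
  apply/pres_classP; rewrite !pres_classM !pres_class_inv.
  by rewrite mulKg mulVg.
have Gw1 : represents_one (wsub G w).
  by rewrite /represents_one clG w1; apply: (mulIg (g 1%g)); rewrite -gM !mul1g.
have size_w : size (wsub G w) <= (K + 4 * L).+1 * n + (K + 4 * L).+1.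
  apply: leq_trans (sizeL w) _.
  by rewrite /w /word_comm !size_cat !size_word_inv !size_nseq; nia.
have := leq_trans (areaK _ Gw1) (leq_mul (leqnn K) (area_le_dehn size_w Gw1)).
rewrite /w /word_comm !wsub_cat !wsub_inv cocycle_comm.
rewrite !expo_G; [|by auto..].
(* Only the diagonal of the determinant survives, since a^n has no c and c^n has no a. *)
rewrite !expo_pow /= GRing.mul0rn GRing.mulr0 GRing.subr0.
rewrite !natz -PoszM absz_nat mulnn => /leq_trans; apply.
rewrite -addnA -[X in X <= _]addn0 leq_add // leq_mul2r; lia.
Qed.

End LowerBound.

Theorem theorem1p1 (P : finpres) (PS : isomorphic (pres_group P) (pres_group stallings)) :
  dehn_equiv (dehn P) (fun n => n ^ 2).
Proof. by split; [exact: dehn_upper | exact: dehn_lower]. Qed.
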